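(* Let $f\colon\mathbb{R}^d\to\,]-\infty,+\infty]$ and $g\colon\mathbb{R}^d\to\,]-\infty,+\infty]$ be proper lower semicontinuous convex functions, and let $h\colon\mathbb{R}^d\to\mathbb{R}$ be a differentiable convex function whose gradient is $L$-Lipschitz continuous, with $L>0$. Assume that the set $\{x\in\mathbb{R}^d : 0\in\partial f(x)+\partial g(x)+\nabla h(x)\}$ is nonempty. Set $\beta=1/L$. Let $\gamma$ be a real number and let $(\tau_n)_{n\geq 1}$ and $(\lambda_n)_{n\geq 1}$ be sequences of strictly positive real numbers. Suppose that there exist $(\tau,\epsilon,\kappa)\in\,]0,1[^3$ and $(\delta,\sigma)\in\,]0,+\infty[^2$ with $$\delta>\frac{\tau^2(1+\tau)+\tau\sigma}{1-\tau^2}$$ such that (i) $\gamma\in\,]0,2\beta\kappa[$; (ii) $\tau\geq\tau_{n+1}\geq\tau_n$ for all $n\geq 1$; (iii) for all $n\geq 1$, $$\epsilon<\lambda_n\leq\frac{\delta-\tau(\tau+\tau^2+\tau\delta+\sigma)}{\alpha\delta(1+\tau+\tau^2+\tau\delta+\sigma)},\qquad\text{where }\alpha=\frac{2\beta}{4\beta-\gamma}.$$ Let $\overline{x}_0=\overline{x}_1\in\mathbb{R}^d$ and, for $n=1,2,\ldots$, define $$\begin{aligned} w_n&=\overline{x}_n+\tau_n(\overline{x}_n-\overline{x}_{n-1}),\\ x_n&=\operatorname{prox}_{\gamma g}(w_n),\\ y_n&=\operatorname{prox}_{\gamma f}(2x_n-w_n-\gamma\nabla h(x_n)),\\ \overline{x}_{n+1}&=w_n+\lambda_n(y_n-x_n).\end{aligned}$$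 Then there exists a point $w\in\mathbb{R}^d$ such that the following hold: 1. $\sum_{n\geq 1}\|\overline{x}_{n+1}-\overline{x}_n\|^2<+\infty$. 2. $(\overline{x}_n)_{n\geq 1}$ converges to $w$. 3. $(x_n)_{n\geq 1}$ converges to $x^\star=\operatorname{prox}_{\gamma g}(w)$, which is a solution of the problem of minimizing $f(x)+g(x)+h(x)$ over $x\in\mathbb{R}^d$.
   Context: $\partial f$ denotes the convex subdifferential, $\partial f(x)=\{u\in\mathbb{R}^d : f(y)-f(x)\geq\langle y-x,u\rangle\ \forall y\in\mathbb{R}^d\}$. The proximal operator of a proper lower semicontinuous convex function $f$ is $\operatorname{prox}_f(x)=\arg\min_{z\in\mathbb{R}^d}\{f(z)+\tfrac12\|z-x\|^2\}$. $L$-Lipschitz continuity of the gradient means $\|\nabla h(x)-\nabla h(y)\|\leq L\|x-y\|$ for all $x,y\in\mathbb{R}^d$. *)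

(* Defs.v *)
From HB Require Import structures.
From mathcomp Require Import all_boot all_order all_algebra.
From mathcomp Require Import all_classical all_reals all_analysis.

Set Implicit Arguments.
Unset Strict Implicit.
Unset Printing Implicit Defensive.

Import Order.TTheory GRing.Theory Num.Theory.
Import numFieldNormedType.Exports.

Local Open Scope classical_set_scope.
Local Open Scope ring_scope.

Section Defs.
Context {R : realType} {d : nat}.
Local Notation E := 'rV[R]_d.

Definition dotv (u v : E) : R := \sum_(i < d) u ord0 i * v ord0 i.

(* The library's norm `|u| on row vectors is the sup norm, hence this
   Euclidean norm. Both induce the same topology, so convergence and
   (lower semi)continuity use the library's topology on 'rV[R]_d. *)
Definition enorm (u : E) : R := Num.sqrt (dotv u u).

Definition proper_efun (f : E -> \bar R) : Prop :=
  (forall x, (-oo < f x)%E) /\ (exists x, (f x < +oo)%E).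

(* The library's convex_function covers real-valued functions only. For
   0 < t < 1 and f > -oo the right-hand side is never a product 0 * +oo nor
   a sum +oo - oo. *)
Definition econvex (f : E -> \bar R) : Prop :=
  forall (x y : E) (t : R), 0 < t < 1 ->
    (f (t *: x + (1 - t) *: y)%R <= t%:E * f x + (1 - t)%:E * f y)%E.

(* Here +oo - +oo = -oo, so for proper f the set is empty when f x = +oo, as
   usual. *)
Definition subdifferential (f : E -> \bar R) (x : E) : set E :=
  [set u | forall y : E, ((dotv (y - x)%R u)%:E <= f y - f x)%E].

Definition gradient (h : E -> R) (x : E) : E :=
  \row_(i < d) 'D_(delta_mx ord0 i) h x.

Definition argmin (F : E -> \bar R) : set E :=
  [set x | forall y, (F x <= F y)%E].

(* For f proper, lower semicontinuous and convex this argmin is a singleton;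
   get selects its element. *)
Definition prox (f : E -> \bar R) (x : E) : E :=
  get (argmin (fun z => (f z + (2^-1 * enorm (z - x) ^+ 2)%R%:E)%E)).

End Defs.

(* Main.v *)
(* Write D w = y - x for the residual of one Davis-Yin step started at w. Firm
   nonexpansiveness of the proximal operators and cocoercivity of the gradient
   (Baillon-Haddad) make -D cocoercive with constant 1 - gamma L / 4 = 1 / (2 alpha),
   and D vanishes at x + gamma v whenever 0 = u + v + grad h x with u, v subgradients
   of f, g at x. With phi_n = |xbar_n - p|^2 for a zero p of D, the energy
   Psi_n = phi_(n+1) - tau_n phi_n + g_n |xbar_(n+1) - xbar_n|^2 drops by at least
   sigma |xbar_(n+2) - xbar_(n+1)|^2 at each step (Bot, Csetnek and Hendrich), so the
   iterates are bounded and their increments square summable. Every cluster point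
   is then a zero of D, and taking p to be a cluster point makes Psi, hence phi, tend
   to 0. *)

Require Import Defs.
From HB Require Import structures.
From mathcomp Require Import all_boot all_order all_algebra.
From mathcomp Require Import all_classical all_reals all_analysis.
From mathcomp Require Import finmap ring lra.

Set Implicit Arguments.
Unset Strict Implicit.
Unset Printing Implicit Defensive.

Import Order.TTheory GRing.Theory Num.Theory.
Import numFieldNormedType.Exports.

Local Open Scope classical_set_scope.
Local Open Scope ring_scope.

(** * Inner product and Euclidean norm on row vectors *)

Section InnerProduct.
Context {R : realType} {d : nat}.
Local Notation E := 'rV[R]_d.
Implicit Types (u v w : E) (a : R).

Lemma dotvC u v : dotv u v = dotv v u.
Proof. by apply: eq_bigr => i _; rewrite mulrC. Qed.

Lemma dotvDl u v w : dotv (u + v) w = dotv u w + dotv v w.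
Proof. by rewrite -big_split; apply: eq_bigr => i _; rewrite mxE mulrDl. Qed.

Lemma dotvZl a u v : dotv (a *: u) v = a * dotv u v.
Proof. by rewrite /dotv mulr_sumr; apply: eq_bigr => i _; rewrite mxE mulrA. Qed.

Lemma dotvNl u v : dotv (- u) v = - dotv u v.
Proof. by rewrite -scaleN1r dotvZl mulN1r. Qed.

Lemma dot0v u : dotv 0 u = 0.
Proof. by rewrite -(scale0r u) dotvZl mul0r. Qed.

Lemma dotvDr u v w : dotv u (v + w) = dotv u v + dotv u w.
Proof. by rewrite dotvC dotvDl !(dotvC _ u). Qed.

Lemma dotvZr a u v : dotv u (a *: v) = a * dotv u v.
Proof. by rewrite dotvC dotvZl dotvC. Qed.

Lemma dotvNr u v : dotv u (- v) = - dotv u v.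
Proof. by rewrite dotvC dotvNl dotvC. Qed.

Definition dotvE := (dotvDl, dotvDr, dotvNl, dotvNr, dotvZl, dotvZr).

Lemma dotv_ge0 u : 0 <= dotv u u.
Proof. by apply: sumr_ge0 => i _; rewrite -expr2 sqr_ge0. Qed.

Lemma enorm_ge0 u : 0 <= enorm u.
Proof. exact: sqrtr_ge0. Qed.

Lemma sqr_enorm u : enorm u ^+ 2 = dotv u u.
Proof. by rewrite sqr_sqrtr// dotv_ge0. Qed.

Lemma ler_enorm u v : (enorm u <= enorm v) = (dotv u u <= dotv v v).
Proof. by rewrite ler_psqrt// qualifE/= dotv_ge0. Qed.

Lemma sqr_coord_le u i : u ord0 i ^+ 2 <= dotv u u.
Proof.
rewrite /dotv (bigD1 i)//= -expr2 lerDl.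
by apply: sumr_ge0 => j _; rewrite -expr2 sqr_ge0.
Qed.

Lemma dotv_eq0 u : dotv u u <= 0 -> u = 0.
Proof.
move=> u0; apply/rowP => i; rewrite mxE.
have := le_trans (sqr_coord_le u i) u0.
by rewrite real_exprn_even_le0 ?num_real//= => /eqP.
Qed.

(* Applied to [a = enorm v / enorm u], this is the Cauchy-Schwarz inequality. *)
Lemma young_dotv a u v : 0 < a ->
  2 * dotv u v <= a * dotv u u + a^-1 * dotv v v.
Proof.
move=> a0; have := dotv_ge0 (a *: u - v); rewrite !dotvE (dotvC v u) => h.
rewrite -subr_ge0.
have -> : a * dotv u u + a^-1 * dotv v v - 2 * dotv u v =
   a^-1 * (a * (a * dotv u u) - a * dotv u v - (a * dotv u v - dotv v v)).
  by field; rewrite gt_eqF.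
by rewrite mulr_ge0// ?invr_ge0 ?(ltW a0)//; lra.
Qed.

Lemma dotv_le_enorm u v : dotv u v <= enorm u * enorm v.
Proof.
have [/eqP u0|u0] := eqVneq (enorm u) 0.
  rewrite sqrtr_eq0 in u0; rewrite (dotv_eq0 u0).
  by rewrite dot0v mulr_ge0// enorm_ge0.
have [/eqP v0|v0] := eqVneq (enorm v) 0.
  rewrite sqrtr_eq0 in v0; rewrite (dotv_eq0 v0).
  by rewrite dotvC dot0v mulr_ge0// enorm_ge0.
have up : 0 < enorm u by rewrite lt_neqAle eq_sym u0 enorm_ge0.
have vp : 0 < enorm v by rewrite lt_neqAle eq_sym v0 enorm_ge0.
have := @young_dotv (enorm v / enorm u) u v (divr_gt0 vp up).
rewrite -!sqr_enorm.
have -> : enorm v / enorm u * enorm u ^+ 2 +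
   (enorm v / enorm u)^-1 * enorm v ^+ 2 = 2 * (enorm u * enorm v).
  by field; rewrite u0 v0.
by rewrite ler_pM2l.
Qed.

Lemma enormD u v : enorm (u + v) <= enorm u + enorm v.
Proof.
rewrite -(@ler_pXn2r _ 2)// ?nnegrE ?addr_ge0 ?enorm_ge0//.
rewrite sqrrD !sqr_enorm !dotvE (dotvC v u).
by have := dotv_le_enorm u v; lra.
Qed.

Lemma enormN u : enorm (- u) = enorm u.
Proof. by rewrite /enorm !dotvE opprK. Qed.

Lemma enormZ a u : 0 <= a -> enorm (a *: u) = a * enorm u.
Proof.
by move=> a0; rewrite /enorm !dotvE mulrA -expr2 sqrtrM ?sqr_ge0// sqrtr_sqr ger0_norm.
Qed.

(** Carries Euclidean estimates over to the topology, which comes from the sup norm. *)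
Lemma mx_norm_le_enorm u : `|u| <= enorm u.
Proof.
rewrite [leLHS]mx_normrE; apply: bigmax_le => [|[i j] _] /=; first exact: enorm_ge0.
rewrite (ord1 i) -sqrtr_sqr ler_wsqrtr//; exact: sqr_coord_le.
Qed.

End InnerProduct.

(** * Euclidean balls, convergence, and minima over compact sets *)

Section Topology.
Context {R : realType} {d : nat}.
Local Notation E := 'rV[R]_d.
Implicit Types (u v w x z : E).

Lemma continuous_dotvv w : continuous (fun z : E => dotv (z - w) (z - w)).
Proof.
rewrite /dotv; apply: continuous_big => [|i _ x]; first exact: add_continuous.
have c : continuous (fun z : E => (z - w) ord0 i).
  have -> : (fun z : E => (z - w) ord0 i) = (fun z => z ord0 i - w ord0 i).
    by apply/funext => z; rewrite !mxE.
  move=> y; apply: continuousB; last exact: cst_continuous.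
  exact: (@coord_continuous R 1 d ord0 i y).
exact: cvgM (c x) (c x).
Qed.

(** Serves twice: proximal minimizers are sought in such a ball, and the iterates cluster in one. *)
Lemma compact_dotvv_ball w (M : R) : compact [set z : E | dotv (z - w) (z - w) <= M].
Proof.
apply: bounded_closed_compact.
  exists (Num.sqrt M + `|w|); split=> [|a /ltW Ma z /= zM]; first exact: num_real.
  apply: le_trans Ma; rewrite -(subrK w z).
  apply: le_trans (ler_normD _ _) _; rewrite lerD2r.
  by rewrite (le_trans (mx_norm_le_enorm _))// ler_wsqrtr.
by apply: (preimage_closed (D := [set r | r <= M])) => [z _|];
  [exact: continuous_dotvv|exact: closed_le].
Qed.

Lemma cvg_enormP (u : nat -> E) w :
  (u n @[n --> \oo] --> w) <-> (enorm (u n - w) @[n --> \oo] --> (0 : R)).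
Proof.
split=> h.
  rewrite -(sqrtr0 R) /enorm; apply: continuous_cvg; first exact: sqrt_continuous.
  have := cvg_comp _ _ h (@continuous_dotvv w w); rewrite subrr.
  by rewrite dot0v.
apply/cvgrPdist_le => e e0; near=> n.
rewrite distrC (le_trans (mx_norm_le_enorm _))//.
near: n; move/cvgrPdist_le : h => /(_ _ e0); apply: filterS => n.
by rewrite sub0r normrN ger0_norm// enorm_ge0.
Unshelve. all: by end_near. Qed.

End Topology.

(** Without a minimizer, the sets where [F] exceeds a finite value [F y], with [y] in [K], form an
    open cover of [K]. In a finite subcover, the index with the least value of [F] lies in none of
    the sets. *)
Lemma lsc_compact_min (R : realType) (T : ptopologicalType) (F : T -> \bar R) (K : set T) :
  lower_semicontinuous F -> (forall x, (-oo < F x)%E) -> compact K -> K !=set0 ->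
  exists2 x, K x & forall y, K y -> (F x <= F y)%E.
Proof.
move=> lscF FNy cK K0; apply: contrapT => nomin.
have lower x : K x -> exists2 y, K y & (F y < F x)%E.
  move=> Kx; apply: contrapT => no; apply: nomin; exists x => // y Ky.
  by rewrite leNgt; apply/negP => yx; apply: no; exists y.
move: cK; rewrite compact_cover => /(_ T [set y | K y /\ (F y < +oo)%E]
  (fun y => [set x | (F y < F x)%E])) [].
- move=> y [Ky Fy]; have Fyf : F y \is a fin_num by rewrite fin_numElt FNy.
  by rewrite -(fineK Fyf); move/lower_semicontinuousP : lscF; exact.
- move=> x Kx; have [y Ky yx] := lower _ Kx; exists y => //; split=> //.
  exact: lt_le_trans yx (leey _).
move=> D DK cov; have [x0 Kx0] := K0.
have [i0 Di0 _] := cov _ Kx0.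
pose i1 : D := [` Di0]%fset.
have [i _ imin] := @arg_minP _ _ _ i1 xpredT (F \o val) isT.
have [j Dj] := cov (val i) (set_mem (DK _ (valP i))).1.
rewrite /= ltNge => /negP; apply.
exact: (imin [` Dj]%fset isT).
Qed.

(** * Subdifferentials and proximal operators *)

Section Prox.
Context {R : realType} {d : nat}.
Local Notation E := 'rV[R]_d.
Implicit Types (F : E -> \bar R) (u v w x y z : E).

Lemma subdifferentialP F x u : proper_efun F ->
  subdifferential F x u <->
  exists2 a, F x = a%:E & forall y b, F y = b%:E -> a + dotv (y - x) u <= b.
Proof.
move=> [FNy [x0 Fx0]]; split=> [h|[a Fx h] y].
  have Fx : F x \is a fin_num.
    rewrite fin_numElt FNy /= ltNge leye_eq; apply/negP => /eqP Fx.
    by have := h x0; rewrite Fx /= addeNy leeNy_eq.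
  exists (fine (F x)); first by rewrite fineK.
  move=> y b Fy; have := h y; rewrite Fy -(fineK Fx) -EFinB lee_fin.
  by lra.
rewrite Fx; have := FNy y; case Fy : (F y) => [b| |]// _; last first.
  by rewrite addye ?leey.
by rewrite -EFinB lee_fin; have := h _ _ Fy; lra.
Qed.

Lemma subdifferential_monotone F x y u v : proper_efun F ->
  subdifferential F x u -> subdifferential F y v -> 0 <= dotv (x - y) (u - v).
Proof.
move=> Fp /(subdifferentialP _ _ Fp)[a Fx xu] /(subdifferentialP _ _ Fp)[b Fy yv].
have := xu _ _ Fy; have := yv _ _ Fx; rewrite !dotvE; lra.
Qed.

Lemma lsc_add_sqr F w : lower_semicontinuous F ->
  lower_semicontinuous (fun z => (F z + (2^-1 * enorm (z - w) ^+ 2)%:E)%E).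
Proof.
move=> Flsc; pose q z := 2^-1 * dotv (z - w) (z - w).
have -> : (fun z => (F z + (2^-1 * enorm (z - w) ^+ 2)%:E)%E) =
          (fun z => (F z + (q z)%:E)%E) by apply/funext => z; rewrite sqr_enorm.
have qc : continuous q.
  by move=> y; exact: cvgM (cvg_cst _) (@continuous_dotvv _ _ w y).
move=> x a aFx.
(* The slack [e] absorbs the variation of [q] near [x]; if [F x = +oo], any positive value will
   do. *)
have [e e0 h] : exists2 e, 0 < e & ((a - q x + e)%:E < F x)%E.
  move: aFx; case: (F x) => [r| |]//=; last by exists 1; rewrite ?ltry.
  rewrite -EFinD lte_fin => h; exists ((r + q x - a) / 2); first lra.
  by rewrite lte_fin; lra.
have [V Vx VF] := Flsc _ _ h.
have /cvgrPdist_lt/(_ _ e0) qe := qc x.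
exists (V `&` [set y | `|q x - q y| < e]); first exact: filterI.
move=> y [Vy qy].
have := VF _ Vy; rewrite -lteBlDr// -EFinB; apply: le_lt_trans.
rewrite lee_fin; have := ltr_normlW qy; lra.
Qed.

(* The subgradient [u0] provides the affine minorant that makes the objective
   of the proximal problem coercive. *)
Lemma prox_argmin F w x0 u0 : proper_efun F -> lower_semicontinuous F ->
  subdifferential F x0 u0 ->
  argmin (fun z => (F z + (2^-1 * enorm (z - w) ^+ 2)%:E)%E) (prox F w).
Proof.
move=> Fp Flsc /(subdifferentialP _ _ Fp)[a Fx0 minor].
rewrite /prox; set G := fun z => _; apply: getPex.
(* Since [<z - w, u0> >= - |z - w|^2 / 4 - |u0|^2], the affine minorant gives [G z >= G x0] once
   [|z - w|^2] exceeds this [M]. *)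
pose M := 4 * (2^-1 * dotv (x0 - w) (x0 - w) + dotv u0 u0 + dotv (x0 - w) u0).
have GNy x : (-oo < G x)%E.
  by rewrite /G; have := Fp.1 x; case: (F x) => // r _; rewrite -EFinD ltNyr.
have outside z : ~ dotv (z - w) (z - w) <= M -> (G x0 <= G z)%E.
  move=> /negP; rewrite -ltNge /G /M !sqr_enorm Fx0.
  have := Fp.1 z; case Fz : (F z) => [b| |]// _; last by rewrite leey.
  have := minor _ _ Fz; have := dotv_ge0 (2^-1 *: (z - w) + u0).
  rewrite -!EFinD lee_fin.
  have -> : z - x0 = (z - w) - (x0 - w) by rewrite opprB addrA subrK.
  rewrite !dotvE [dotv u0 z]dotvC [dotv u0 w]dotvC; lra.
have Kx0 : dotv (x0 - w) (x0 - w) <= M.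
  have := dotv_ge0 (2^-1 *: (x0 - w) + u0); rewrite /M !dotvE.
  rewrite [dotv u0 x0]dotvC [dotv u0 w]dotvC; lra.
have [|x Kx xmin] := lsc_compact_min (lsc_add_sqr (w := w) Flsc) GNy
  (@compact_dotvv_ball _ _ w M).
  by exists x0.
exists x => z; have [/xmin//|/outside] := pselect (dotv (z - w) (z - w) <= M).
by apply: le_trans; exact: xmin.
Qed.

(** Compare [x] with [t y + (1 - t) x]: convexity bounds [F] there, and after division by [t] the
    quadratic term leaves only an error of order [t]. *)
Lemma argmin_subdifferential F w x : proper_efun F -> econvex F ->
  argmin (fun z => (F z + (2^-1 * enorm (z - w) ^+ 2)%:E)%E) x ->
  subdifferential F x (w - x).
Proof.
move=> Fp Fcvx xmin.
have [x0 Fx0] := Fp.2.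
have [a Fx] : exists a, F x = a%:E.
  have := xmin x0; have := Fp.1 x; have := Fp.1 x0; move: Fx0.
  by case: (F x) => [a| |]; [exists a|case: (F x0)|].
apply/(subdifferentialP _ _ Fp); exists a => // y b Fy.
have step t : 0 < t < 1 ->
    a + dotv (y - x) (w - x) <= b + t * (2^-1 * dotv (y - x) (y - x)).
  move=> t01; have := Fcvx y x t t01; have := xmin (t *: y + (1 - t) *: x).
  have := Fp.1 (t *: y + (1 - t) *: x).
  rewrite Fx Fy !sqr_enorm; case: (F _) => [c| |]//= _.
  rewrite -!EFinM -!EFinD !lee_fin.
  have -> : t *: y + (1 - t) *: x - w = t *: (y - x) - (w - x).
    by apply/rowP => i; rewrite !mxE; ring.
  have -> : dotv (x - w) (x - w) = dotv (w - x) (w - x).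
    by rewrite -opprB dotvNl dotvNr opprK.
  move: (y - x) (w - x) => p q; rewrite !dotvE [dotv q p]dotvC.
  have /andP[t0 _] := t01; nra.
rewrite -subr_ge0; apply/ler_addgt0Pr => e e0.
set D := 2^-1 * dotv (y - x) (y - x) in step.
have D0 : 0 <= D by rewrite mulr_ge0 ?dotv_ge0.
(* This value of [t] lies in ]0,1[ and satisfies [t D <= e], which replaces a passage to the
   limit. *)
have De : 0 < e / (D + e + 1) < 1.
  by rewrite divr_gt0 ?ltr_pdivrMr; lra.
have := step _ De.
have : e / (D + e + 1) * D <= e.
  by rewrite mulrAC ler_pdivrMr; nra.
lra.
Qed.

Lemma prox_subdifferential F w x0 u0 :
  proper_efun F -> lower_semicontinuous F -> econvex F ->
  subdifferential F x0 u0 -> subdifferential F (prox F w) (w - prox F w).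
Proof.
move=> Fp Flsc Fcvx h; apply: argmin_subdifferential => //.
exact: prox_argmin h.
Qed.

(** Monotonicity of the subdifferential at [prox F w] and [x] yields [0 <= - |prox F w - x|^2]. *)
Lemma prox_unique F w x : proper_efun F -> lower_semicontinuous F -> econvex F ->
  subdifferential F x (w - x) -> prox F w = x.
Proof.
move=> Fp Flsc Fcvx h; apply/eqP; rewrite -subr_eq0; apply/eqP/dotv_eq0.
have := subdifferential_monotone Fp (prox_subdifferential w Fp Flsc Fcvx h) h.
have -> : w - prox F w - (w - x) = - (prox F w - x).
  by apply/rowP => i; rewrite !mxE; ring.
by rewrite dotvNr oppr_ge0.
Qed.

Lemma prox_firmly_nonexpansive F w w' x0 u0 :
  proper_efun F -> lower_semicontinuous F -> econvex F -> subdifferential F x0 u0 ->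
  0 <= dotv (prox F w - prox F w') ((w - w') - (prox F w - prox F w')).
Proof.
move=> Fp Flsc Fcvx h.
have := subdifferential_monotone Fp (prox_subdifferential w Fp Flsc Fcvx h)
  (prox_subdifferential w' Fp Flsc Fcvx h).
congr (_ <= dotv _ _); move: (prox F w) (prox F w') => p q.
by apply/rowP => i; rewrite !mxE; ring.
Qed.

Lemma prox_nonexpansive F w w' x0 u0 :
  proper_efun F -> lower_semicontinuous F -> econvex F ->
  subdifferential F x0 u0 -> enorm (prox F w - prox F w') <= enorm (w - w').
Proof.
move=> Fp Flsc Fcvx h; rewrite ler_enorm.
have := prox_firmly_nonexpansive w w' Fp Flsc Fcvx h.
move: (w - w') (prox F w - prox F w') => p q.
have := dotv_ge0 (p - q); rewrite !dotvE [dotv p q]dotvC; lra.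
Qed.

End Prox.

(** * Passing from a function to its positive multiples *)

Section Scaling.
Context {R : realType} {d : nat} (c : R) (F : 'rV[R]_d -> \bar R).
Hypothesis c0 : 0 < c.
Local Notation cF := (fun z => c%:E * F z)%E.

Lemma proper_efun_scale : proper_efun F -> proper_efun cF.
Proof.
move=> [FNy [x Fx]]; split=> [y|].
  by have := FNy y; case: (F y) => [r _| _|]//; rewrite ?ltNyr ?gt0_muley ?lte_fin.
exists x; move: Fx; have := FNy x.
by case: (F x) => [r _| |]// _; rewrite -EFinM ltry.
Qed.

Lemma lower_semicontinuous_scale : lower_semicontinuous F -> lower_semicontinuous cF.
Proof.
move=> Flsc x a; rewrite -lte_pdivrMl// -EFinM => /Flsc[V Vx VF].
by exists V => // y /VF; rewrite EFinM lte_pdivrMl.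
Qed.

Lemma econvex_scale : proper_efun F -> econvex F -> econvex cF.
Proof.
move=> [FNy _] Fcvx x y t t01; have /andP[t0 t1] := t01.
have := Fcvx x y t t01; have := FNy (t *: x + (1 - t) *: y).
have := FNy x; have := FNy y.
have c' : (0 < c%:E)%E by rewrite lte_fin.
have t' : (0 < t%:E)%E by rewrite lte_fin.
have s' : (0 < (1 - t)%:E)%E by rewrite lte_fin subr_gt0.
case: (F x) => [r| |]//; case: (F y) => [s| |]// _ _;
  [|by rewrite ?gt0_muley ?addey ?addye ?leey..].
case: (F _) => [q| |]//= _.
by rewrite -!EFinM -!EFinD !lee_fin => /(ler_wpM2l (ltW c0)); lra.
Qed.

Lemma subdifferential_scale x u : proper_efun F ->
  subdifferential cF x (c *: u) <-> subdifferential F x u.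
Proof.
move=> Fp; have cFp := proper_efun_scale Fp.
split=> [/(subdifferentialP _ _ cFp)|/(subdifferentialP _ _ Fp)] [a Fx h].
  apply/(subdifferentialP _ _ Fp).
  move: Fx; have := Fp.1 x; case Fxr : (F x) => [r| |]// _ Fx; last first.
    by move: Fx; rewrite gt0_muley ?lte_fin.
  exists r => // y b Fy; have := h y (c * b).
  rewrite Fy => /(_ erefl); move: Fx => [<-]; rewrite dotvZr -mulrDr.
  by rewrite ler_pM2l.
apply/(subdifferentialP _ _ cFp); exists (c * a); first by rewrite Fx.
move=> y b; have := Fp.1 y; case Fy : (F y) => [r| |]// _; last first.
  by rewrite gt0_muley ?lte_fin.
by move=> [<-]; rewrite dotvZr -mulrDr ler_pM2l//; exact: h.
Qed.

End Scaling.

(** * Smooth convex functions: descent lemma and cocoercivity of the gradient *)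

Section Smooth.
Context {R : realType} {d : nat}.
Local Notation E := 'rV[R]_d.
Variable h : E -> R.
Hypothesis h_diff : forall x, differentiable h x.

Lemma deriveE_gradient (x v : E) : 'D_v h x = dotv (gradient h x) v.
Proof.
rewrite deriveE// [in LHS](row_sum_delta v) linear_sum; apply: eq_bigr => i _.
by rewrite linearZ/= !mxE deriveE// mulrC.
Qed.

Lemma is_derive_line (x v : E) (t : R) :
  is_derive t 1 (fun s : R => h (x + s *: v)) (dotv (gradient h (x + t *: v)) v).
Proof.
have e : (fun s : R => s^-1 *: (((fun s : R => h (x + s *: v)) \o shift t) (s *: 1) -
            h (x + t *: v))) =
         (fun s : R => s^-1 *: ((h \o shift (x + t *: v)) (s *: v) - h (x + t *: v))).
  apply/funext => s /=; congr (_ *: (h _ - _)).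
  by rewrite [s *: 1]mulr1 scalerDl addrCA.
have := @diff_derivable _ _ _ h (x + t *: v) v (h_diff _).
rewrite -deriveE_gradient => dh; split; first by rewrite /derivable e.
by rewrite /derive e.
Qed.

Section Convex.
Hypothesis h_convex : convex_function [set: convex_lmodType E] h.

(** By convexity the difference quotients of [h] along [y - x] over ]0,1] never exceed [h y - h x];
    at 0 they tend to the directional derivative. *)
Lemma convex_gradient_le (x y : E) : h x + dotv (gradient h x) (y - x) <= h y.
Proof.
have slope s : 0 < s <= 1 -> s^-1 * (h (x + s *: (y - x)) - h x) <= h y - h x.
  move=> /andP[s0 s1].
  have : h (s *: y + (1 - s) *: x) <= s * h y + (1 - s) * h x.
    exact: (@h_convex (Itv01 (ltW s0) s1) y x (in_setT _) (in_setT _)).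
  have -> : s *: y + (1 - s) *: x = x + s *: (y - x).
    by apply/rowP => i; rewrite !mxE; ring.
  by move=> hs; rewrite mulrC ler_pdivrMr//; lra.
rewrite -lerBrDl; apply/ler_addgt0Pr => e e0.
have [r r0 hr] : exists2 r, 0 < r & forall s : R, 0 < s < r ->
    dotv (gradient h x) (y - x) - s^-1 * (h (x + s *: (y - x)) - h x) < e.
  have /cvgrPdist_lt/(_ _ e0)/nbhs_ballP[r /= r0 hr] :=
    @diff_derivable _ _ _ h x (y - x) (h_diff x).
  exists r => // s /andP[s0 sr]; rewrite -deriveE_gradient addrC.
  have := hr s; rewrite /ball /= sub0r normrN gtr0_norm// => /(_ sr).
  rewrite gt_eqF// => /(_ isT)/ltr_normlW; rewrite [x + _]addrC addrC; exact.
pose s := Num.min (r / 2) 1.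
have s0 : 0 < s by rewrite lt_min divr_gt0//=.
have sr : s < r by rewrite gt_min; apply/orP; left; lra.
have s1 : s <= 1 by rewrite ge_min lexx orbT.
have := hr s; have := slope s; rewrite s0 sr s1 => /(_ isT) + /(_ isT); lra.
Qed.

Variable L : R.
Hypotheses (L0 : 0 < L) (h_lip : forall x y,
  enorm (gradient h x - gradient h y) <= L * enorm (x - y)).

Lemma descent_lemma (x y : E) :
  h y <= h x + dotv (gradient h x) (y - x) + L / 2 * dotv (y - x) (y - x).
Proof.
set v := y - x; set a := dotv (gradient h x) v; set b := L / 2 * dotv v v.
(* The claim reads [psi 1 <= psi 0]. By the mean value theorem it suffices that [dpsi t <= 0], where
   the Lipschitz bound and Cauchy-Schwarz give [L t |v|^2 = 2 t b]. *)
pose psi (t : R) := h (x + t *: v) - t * a - t ^+ 2 * b.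
pose dpsi (t : R) := dotv (gradient h (x + t *: v)) v - a - 2 * t * b.
have psi' (t : R) : is_derive t 1 psi (dpsi t).
  have ? := is_derive_line x v t.
  rewrite /psi /dpsi; apply: is_derive_eq.
  rewrite /GRing.scale /=; ring.
have cpsi : {within `[0, 1], continuous psi}.
  apply: derivable_within_continuous => t _; exact: (@ex_derive _ _ _ _ _ _ _ (psi' t)).
have [t + ] := MVT ltr01 (fun t _ => psi' t) cpsi.
rewrite in_itv /= => /andP[t0 t1].
have : dpsi t <= 0.
  have := dotv_le_enorm (gradient h (x + t *: v) - gradient h x) v.
  have := h_lip (x + t *: v) x.
  have -> : x + t *: v - x = t *: v by rewrite addrC addKr.
  rewrite enormZ ?(ltW t0)// => /(ler_wpM2r (enorm_ge0 v)) h1 h2.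
  have := le_trans h2 h1.
  have -> : L * (t * enorm v) * enorm v = L * t * enorm v ^+ 2 by ring.
  rewrite sqr_enorm /dpsi /a /b !dotvE; lra.
have xvy : x + 1 *: v = y by rewrite scale1r addrC subrK.
rewrite /psi xvy scale0r addr0 expr1n expr0n /=; lra.
Qed.

Lemma baillon_haddad (x y : E) :
  dotv (gradient h x - gradient h y) (gradient h x - gradient h y) <=
  L * dotv (gradient h x - gradient h y) (x - y).
Proof.
(* Evaluate [h] at the gradient step [w - L^-1 q]: convexity at [u] bounds it from below, the
   descent lemma at [w] from above. Adding the instances for [x, y] and [y, x] cancels the function
   values. *)
have half u w : h u - h w + dotv (gradient h u) (w - u) <=
    - (L^-1 / 2) * dotv (gradient h w - gradient h u) (gradient h w - gradient h u).
  set q := gradient h w - gradient h u.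
  have := convex_gradient_le u (w - L^-1 *: q).
  have := descent_lemma w (w - L^-1 *: q).
  have -> : w - L^-1 *: q - w = - (L^-1 *: q) by rewrite addrC addKr.
  have -> : w - L^-1 *: q - u = (w - u) - L^-1 *: q by rewrite addrAC.
  have -> : gradient h w = gradient h u + q by rewrite addrC subrK.
  rewrite [dotv _ (w - u - _)]dotvDr [dotv (gradient h u + q) _]dotvDl.
  rewrite !(dotvNl, dotvNr) !(dotvZl, dotvZr).
  have -> : L / 2 * - - (L^-1 * (L^-1 * dotv q q)) = L^-1 / 2 * dotv q q.
    by field; rewrite gt_eqF.
  lra.
have := half x y; have := half y x; rewrite -(opprB (gradient h x)) -(opprB x).
rewrite [dotv (- _) _]dotvNl !dotvNr opprK => h1 h2.
rewrite -ler_pdivrMl// [dotv _ (x - y)]dotvDl [dotv (- _) (x - y)]dotvNl; lra.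
Qed.

End Convex.

End Smooth.

(** * The Davis-Yin residual and its cocoercivity *)

Section DavisYin.
Context {R : realType} {d : nat}.
Local Notation E := 'rV[R]_d.

(** The step size is absorbed in the arguments, which stand for [gamma f], [gamma g] and [gamma]
    times the gradient. *)
Definition davis_yin_residual (F G : E -> \bar R) (C : E -> E) (w : E) : E :=
  prox F (2 *: prox G w - w - C (prox G w)) - prox G w.

(* The three hypotheses are firm nonexpansiveness of the two proximal operators
   and Baillon-Haddad; a square in [c - c'] is then completed. *)
Lemma davis_yin_step_cocoercive (w w' x x' y y' c c' : E) (gamma L : R) :
  0 < gamma -> 0 < L ->
  0 <= dotv (x - x') ((w - w') - (x - x')) ->
  0 <= dotv (y - y')
    ((2 *: x - w - gamma *: c) - (2 *: x' - w' - gamma *: c') - (y - y')) ->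
  dotv (c - c') (c - c') <= L * dotv (c - c') (x - x') ->
  (1 - gamma * L / 4) * dotv (y - x - (y' - x')) (y - x - (y' - x')) <=
    - dotv (w - w') (y - x - (y' - x')).
Proof.
move=> g0 L0.
have -> : (2 *: x - w - gamma *: c) - (2 *: x' - w' - gamma *: c') - (y - y') =
    2 *: (x - x') - (w - w') - gamma *: (c - c') - (y - y').
  by apply/rowP => i; rewrite !mxE; ring.
have -> : y - x - (y' - x') = (y - y') - (x - x').
  by apply/rowP => i; rewrite !mxE; ring.
move: (x - x') (y - y') (w - w') (c - c') => X Y P C hX hY hC.
(* This is [|C - (L / 2) (X - Y)|^2] weighted by [gamma / L]; its last term is the loss
   [gamma L / 4] in the constant. *)
have hsq : 0 <= gamma * (L^-1 * dotv C C - dotv C (X - Y) + L / 4 * dotv (X - Y) (X - Y)).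
  rewrite mulr_ge0 ?(ltW g0)//.
  have := mulr_ge0 (ltW (etrans (invr_gt0 L) L0)) (dotv_ge0 (C - (L / 2) *: (X - Y))).
  rewrite !(dotvDl C) !(dotvDr _ C) !(dotvNl, dotvNr) !(dotvZl, dotvZr) [dotv (X - Y) C]dotvC.
  move: (dotv C C) (dotv C (X - Y)) (dotv (X - Y) (X - Y)) => a b e.
  congr (_ <= _); field; by rewrite gt_eqF.
have hC' : gamma * (L^-1 * dotv C C) <= gamma * dotv C X.
  by rewrite ler_pM2l// ler_pdivrMl.
move: hX hY hsq hC'; rewrite !dotvE.
rewrite [dotv Y X]dotvC [dotv Y P]dotvC [dotv Y C]dotvC [dotv X P]dotvC.
lra.
Qed.

Lemma davis_yin_cocoercive (F G : E -> \bar R) (h : E -> R) (gamma L : R)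
    (xF uF xG uG w w' : E) :
  proper_efun F -> lower_semicontinuous F -> econvex F -> subdifferential F xF uF ->
  proper_efun G -> lower_semicontinuous G -> econvex G -> subdifferential G xG uG ->
  (forall x, differentiable h x) ->
  convex_function [set: convex_lmodType E] h ->
  (forall x y, enorm (gradient h x - gradient h y) <= L * enorm (x - y)) ->
  0 < L -> 0 < gamma ->
  let D := davis_yin_residual F G (fun x => gamma *: gradient h x) in
  (1 - gamma * L / 4) * dotv (D w - D w') (D w - D w') <= - dotv (w - w') (D w - D w').
Proof.
move=> Fp Fl Fc hF Gp Gl Gc hG hd hc hl L0 g0 /=; rewrite /davis_yin_residual.
have mG := prox_firmly_nonexpansive w w' Gp Gl Gc hG.
have mF := prox_firmly_nonexpansive (2 *: prox G w - w - gamma *: gradient h (prox G w))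
  (2 *: prox G w' - w' - gamma *: gradient h (prox G w')) Fp Fl Fc hF.
have mC := baillon_haddad hd hc L0 hl (prox G w) (prox G w').
exact: (davis_yin_step_cocoercive g0 L0 mG mF mC).
Qed.

End DavisYin.

(** * Inertial Krasnoselskii-Mann iteration for a cocoercive residual *)

Section InertialKM.
Context {R : realType} {d : nat}.
Local Notation E := 'rV[R]_d.
Variables (D : E -> E) (c : R).
Hypothesis c0 : 0 < c.
Hypothesis D_coco : forall w w',
  c * dotv (D w - D w') (D w - D w') <= - dotv (w - w') (D w - D w').

Lemma cocoercive_lipschitz w w' : enorm (D w - D w') <= c^-1 * enorm (w - w').
Proof.
rewrite ler_pdivlMl//.
have [->|n0] := eqVneq (enorm (D w - D w')) 0; first by rewrite mulr0 enorm_ge0.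
have np : 0 < enorm (D w - D w') by rewrite lt_neqAle eq_sym n0 enorm_ge0.
rewrite -(ler_pM2r np) -mulrA -expr2 sqr_enorm (le_trans (D_coco w w'))//.
by rewrite -dotvNl (le_trans (dotv_le_enorm _ _))// enormN.
Qed.

Variables (tau_ lam : nat -> R) (tau eps delta sigma : R) (x : nat -> E).
Hypotheses (tau_ge0 : forall n, 0 <= tau_ n)
  (tau_nd : forall n, tau_ n <= tau_ n.+1) (tau_le : forall n, tau_ n <= tau)
  (tau0 : 0 < tau) (tau1 : tau < 1) (eps0 : 0 < eps) (delta0 : 0 < delta)
  (sigma0 : 0 < sigma).
Let K := tau + tau ^+ 2 + tau * delta + sigma.
(** The map [w + 2 c D w] is nonexpansive in [w], and [mu n] is the relaxation parameter relative to
    it. *)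
Let mu n := lam n / (2 * c).
Hypotheses (lam_ge : forall n, eps <= lam n)
  (mu_le : forall n, mu n * (delta * (1 + K)) <= delta - tau * K).
(** Indices start at 0: [tau_ n], [lam n] and [W n] belong to the step that produces [x n.+2]. *)
Let W n := x n.+1 + tau_ n *: (x n.+1 - x n).
Hypotheses (x01 : x 0%N = x 1%N) (xS : forall n, x n.+2 = W n + lam n *: D (W n)).

Let Del n := dotv (x n.+1 - x n) (x n.+1 - x n).
Let g n := tau_ n * (1 + tau_ n) + tau_ n * (1 - mu n) * delta.

Let K0 : 0 < K.
Proof.
have := tau0; have := sigma0; rewrite /K; have := mulr_gt0 tau0 delta0.
by have := exprn_gt0 2 tau0; lra.
Qed.

Let lam0 n : 0 < lam n. Proof. exact: lt_le_trans (lam_ge n). Qed.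

Let mu0 n : 0 < mu n. Proof. by rewrite divr_gt0// mulr_gt0. Qed.

Let mu1 n : mu n < 1.
Proof.
rewrite ltNge; apply/negP => m1; have := mu_le n.
have : delta * (1 + K) <= mu n * (delta * (1 + K)).
  by rewrite ler_peMl// mulr_ge0 ?(ltW delta0)//; have := K0; lra.
have := mulr_gt0 tau0 K0; have := mulr_gt0 delta0 K0; lra.
Qed.

Let Del_ge0 n : 0 <= Del n. Proof. exact: dotv_ge0. Qed.

Let g_ge0 n : 0 <= g n.
Proof.
have m1 : 0 <= 1 - mu n by rewrite subr_ge0 ltW.
have t0 := tau_ge0 n; have d0 := ltW delta0.
by apply: addr_ge0; [apply: mulr_ge0; rewrite ?addr_ge0|do 2?apply: mulr_ge0].
Qed.

Let g_le n : g n <= K - sigma.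
Proof.
have := tau_ge0 n; have := tau_le n; have := mu0 n; have := mu1 n; move=> m1 m0 tl tg.
have h1 : tau_ n * (1 - mu n) <= tau.
  by rewrite (le_trans _ tl)// ler_piMr//; lra.
have h2 : tau_ n ^+ 2 <= tau ^+ 2 by rewrite ler_pXn2r ?nnegrE// (ltW tau0).
have := ler_wpM2r (ltW delta0) h1; rewrite /g /K; lra.
Qed.

Section Lyapunov.
Variable p : E.
Hypothesis Dp : D p = 0.
Let phi n := dotv (x n - p) (x n - p).
(* The weight [g n] is what remains on [Del n] in [phi_step], where Young's
   inequality is applied with parameter [1 / (tau_ n + delta * mu n)]. *)
Let Psi n := phi n.+1 - tau_ n * phi n + g n * Del n.

Let phi_ge0 n : 0 <= phi n. Proof. exact: dotv_ge0. Qed.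

Let phi_step n :
  phi n.+2 <= (1 + tau_ n) * phi n.+1 - tau_ n * phi n + g n * Del n -
     (1 - mu n) * delta / (tau_ n + delta * mu n) * Del n.+1.
Proof.
set t := tau_ n; set m := mu n; set l := lam n; set s := t + delta * m.
have t0 : 0 <= t := tau_ge0 n. have m0 : 0 < m := mu0 n. have m1 : m < 1 := mu1 n.
have s0 : 0 < s by rewrite ltr_wpDl// mulr_gt0.
have lm : l = 2 * c * m by rewrite /m /mu mulrC divfK// gt_eqF// mulr_gt0.
(* Cocoercivity between [W n] and the zero [p], with [D (W n)] rewritten through [x n.+2 - W n]. *)
have decr : phi n.+2 <= dotv (W n - p) (W n - p) -
    (1 - m) / m * dotv (x n.+2 - W n) (x n.+2 - W n).
  have := D_coco (W n) p; rewrite Dp subr0 => coco.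
  have := xS n; rewrite -/l => xS'.
  have -> : x n.+2 - W n = l *: D (W n) by rewrite xS' addrC addKr.
  rewrite /phi; have -> : x n.+2 - p = (W n - p) + l *: D (W n) by rewrite xS' addrAC.
  rewrite [dotv (_ + _) _]dotvDl [dotv (W n - p) (_ + _)]dotvDr [dotv (l *: _) (_ + _)]dotvDr.
  rewrite !(dotvZl, dotvZr) [dotv (D _) (_ - p)]dotvC.
  have := ler_wpM2l (ltW (lam0 n)) coco; rewrite -/l lm.
  have -> : (1 - m) / m * (2 * c * m * (2 * c * m * dotv (D (W n)) (D (W n)))) =
     (1 - m) * (2 * c * (2 * c * m)) * dotv (D (W n)) (D (W n)).
    by field; rewrite gt_eqF.
  lra.
(* The identity [|(1 + t) a - t b|^2 = (1 + t) |a|^2 - t |b|^2 + t (1 + t) |a - b|^2]. *)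
have Wp : dotv (W n - p) (W n - p) =
    (1 + t) * phi n.+1 - t * phi n + t * (1 + t) * Del n.
  rewrite /phi /Del.
  have -> : W n - p = (x n.+1 - p) + t *: ((x n.+1 - p) - (x n - p)).
    by apply/rowP => i; rewrite /W -/t !mxE; ring.
  have -> : x n.+1 - x n = (x n.+1 - p) - (x n - p).
    by apply/rowP => i; rewrite !mxE; ring.
  move: (x n.+1 - p) (x n - p) => a b; rewrite !dotvE [dotv b a]dotvC; ring.
(* Young's inequality with weight [s^-1]; the choice [s = t + delta m] turns [1 - t / s] into
   [delta m / s]. *)
have xW : delta * m / s * Del n.+1 - t * delta * m * Del n <=
    dotv (x n.+2 - W n) (x n.+2 - W n).
  have -> : x n.+2 - W n = (x n.+2 - x n.+1) - t *: (x n.+1 - x n).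
    by apply/rowP => i; rewrite /W -/t !mxE; ring.
  have si0 : 0 < s^-1 by rewrite invr_gt0.
  have := ler_wpM2l t0 (young_dotv (x n.+2 - x n.+1) (x n.+1 - x n) si0).
  rewrite invrK /Del; move: (x n.+2 - x n.+1) (x n.+1 - x n) => a b.
  rewrite !dotvE [dotv b a]dotvC.
  have -> : delta * m / s = 1 - t * s^-1.
    by rewrite /s; field; rewrite -/s gt_eqF.
  rewrite {2}/s; lra.
have m1m : 0 <= (1 - m) / m by rewrite divr_ge0 ?(ltW m0)// subr_ge0 ltW.
have := ler_wpM2l m1m xW.
have -> : (1 - m) / m * (delta * m / s * Del n.+1 - t * delta * m * Del n) =
   (1 - m) * delta / s * Del n.+1 - (1 - m) * t * delta * Del n.
  by field; rewrite !gt_eqF.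
move=> xW'.
have : g n = t * (1 + t) + t * (1 - m) * delta by [].
move: decr; rewrite Wp => decr ->; lra.
Qed.

(** The bound [mu_le] makes the coefficient of [Del n.+1] in [phi_step] at least [K], while
    [g n.+1 <= K - sigma], so [sigma] is left over. Monotonicity of [tau_] handles the terms in
    [phi n.+1]. *)
Let Psi_step n : Psi n.+1 <= Psi n - sigma * Del n.+1.
Proof.
have t0 := tau_ge0 n; have m0 := mu0 n.
have s0 : 0 < tau_ n + delta * mu n by rewrite ltr_wpDl// mulr_gt0.
have Ks : K <= (1 - mu n) * delta / (tau_ n + delta * mu n).
  rewrite ler_pdivlMr//; have := mu_le n.
  have := ler_wpM2l (ltW K0) (tau_le n); lra.
have h1 := phi_step n.
have h2 := ler_wpM2r (Del_ge0 n.+1) Ks.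
have h3 := ler_wpM2r (Del_ge0 n.+1) (g_le n.+1).
have h4 := ler_wpM2r (phi_ge0 n.+1) (tau_nd n).
rewrite /Psi; lra.
Qed.

Let Psi_le n : Psi n.+1 <= Psi n.
Proof. have := Psi_step n; have := mulr_ge0 (ltW sigma0) (Del_ge0 n.+1); lra. Qed.

Let Psi_nincr m n : (m <= n)%N -> Psi n <= Psi m.
Proof. by move=> /subnK <-; elim: (n - m)%N => // k IH; exact: le_trans (Psi_le _) IH. Qed.

Let phi_le_Psi n : phi n.+1 <= tau * phi n + Psi n.
Proof.
have := ler_wpM2r (phi_ge0 n) (tau_le n); have := mulr_ge0 (g_ge0 n) (Del_ge0 n).
rewrite /Psi; lra.
Qed.

(* Since [phi n.+1 <= tau * phi n + Psi n] with [tau < 1] and [Psi] nonincreasing,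
   one index at which both are small controls all later ones. *)
Let phi_trap N e : phi N <= e -> Psi N <= e ->
  forall n, (N <= n)%N -> phi n <= e / (1 - tau).
Proof.
have s1 : 0 < 1 - tau by rewrite subr_gt0.
move=> pe Pe n /subnK <-; elim: (n - N)%N => [|k IH].
  rewrite (le_trans pe)// ler_pdivlMr// ler_piMr//; first exact: le_trans (phi_ge0 N) pe.
  by rewrite gerBl ltW.
have := phi_le_Psi (k + N); have := Psi_nincr (leq_addl k N).
have := ler_wpM2l (ltW tau0) IH.
have -> : tau * (e / (1 - tau)) = e / (1 - tau) - e.
  by field; rewrite gt_eqF.
by rewrite addSn; lra.
Qed.

(** Equal starting points make [Del 0] vanish. *)
Let Psi0_le : Psi 0%N <= phi 0%N.
Proof.
rewrite /Psi /Del -x01 subrr dot0v mulr0 addr0 /phi -x01.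
by have := mulr_ge0 (tau_ge0 0%N) (dotv_ge0 (x 0%N - p)); lra.
Qed.

Let B := phi 0%N / (1 - tau).

Lemma km_bounded n : dotv (x n - p) (x n - p) <= B.
Proof. exact: (phi_trap (lexx _) Psi0_le). Qed.

(** [Psi_step] telescopes, and [- Psi n <= tau_ n * phi n <= B]. *)
Lemma km_sum_bounded n : sigma * \sum_(0 <= k < n) Del k.+1 <= phi 0%N + B.
Proof.
have sum : sigma * \sum_(0 <= k < n) Del k.+1 <= Psi 0%N - Psi n.
  elim: n => [|n IH]; first by rewrite big_nil mulr0 subrr.
  by rewrite big_nat_recr//= mulrDr; have := Psi_step n; lra.
apply: (le_trans sum).
have := Psi0_le; have := mulr_ge0 (g_ge0 n) (Del_ge0 n); have := phi_ge0 n.+1.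
have := ler_wpM2r (phi_ge0 n) (ltW (le_lt_trans (tau_le n) tau1)).
have : phi n <= B := km_bounded n.
rewrite mul1r; have : Psi n = phi n.+1 - tau_ n * phi n + g n * Del n by [].
lra.
Qed.

(** At an index where [phi] and [Del] are both small, [Psi] is small too, and [phi_trap] then
    controls every later [phi]. *)
Lemma km_cvg_of_cluster :
  (forall e, 0 < e -> exists N, forall n, (N <= n)%N -> Del n <= e) ->
  (forall e N, 0 < e -> exists2 n, (N <= n)%N & dotv (x n - p) (x n - p) <= e) ->
  x n @[n --> \oo] --> p.
Proof.
move=> Del_to0 cl; apply/cvg_enormP/cvgrPdist_le => e e0.
have s1 : 0 < 1 - tau by rewrite subr_gt0.
have K2 : 0 < 4 + K by have := K0; lra.
(* The divisor [4 + K] comes from [Psi n <= 2 phi n + 2 Del n + K Del n]; the factor [1 - tau]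
   offsets the division in [phi_trap]. *)
have a0 : 0 < e ^+ 2 * (1 - tau) / (4 + K) by rewrite divr_gt0// mulr_gt0// exprn_gt0.
have [N hN] := Del_to0 _ a0; have [n Nn hn] := cl _ N a0.
have phin : phi n <= e ^+ 2 * (1 - tau).
  rewrite (le_trans hn)// ler_pdivrMr// ler_peMr//; last by have := K0; lra.
  by rewrite mulr_ge0 ?sqr_ge0 ?(ltW s1).
have Psin : Psi n <= e ^+ 2 * (1 - tau).
  have : phi n.+1 <= 2 * phi n + 2 * Del n.
    rewrite /phi /Del; have := dotv_ge0 ((x n.+1 - x n) - (x n - p)).
    have -> : x n.+1 - p = (x n.+1 - x n) + (x n - p) by rewrite addrA subrK.
    move: (x n.+1 - x n) (x n - p) => u v; rewrite !dotvE [dotv v u]dotvC; lra.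
  have -> : e ^+ 2 * (1 - tau) = (4 + K) * (e ^+ 2 * (1 - tau) / (4 + K)).
    by field; rewrite gt_eqF.
  have := mulr_ge0 (tau_ge0 n) (phi_ge0 n).
  have := ler_wpM2r (Del_ge0 n) (g_le n); have := hN _ Nn.
  have := ler_wpM2l (ltW K0) (hN _ Nn).
  have := mulr_ge0 (ltW sigma0) (Del_ge0 n).
  move: hn; rewrite -/(phi n) /Psi; lra.
exists n => // m /= nm; rewrite sub0r normrN ger0_norm ?enorm_ge0//.
rewrite -(@ler_pXn2r _ 2)// ?nnegrE ?enorm_ge0 ?(ltW e0)// sqr_enorm.
have := phi_trap phin Psin nm; rewrite mulfK// gt_eqF//.
Qed.

End Lyapunov.

Variable p : E.
Hypothesis Dp : D p = 0.

Let B := dotv (x 0%N - p) (x 0%N - p) * (1 + (1 - tau)^-1).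

Lemma inertial_km_summable n :
  \sum_(0 <= k < n) dotv (x k.+2 - x k.+1) (x k.+2 - x k.+1) <= B / sigma.
Proof.
rewrite ler_pdivlMr// mulrC (le_trans (km_sum_bounded Dp n))//.
by rewrite /B mulrDr mulr1.
Qed.

Let increments_small e : 0 < e -> exists N, forall n, (N <= n)%N -> Del n <= e.
Proof.
move=> e0.
have : cvgn (series (fun k => Del k.+1)).
  apply: nondecreasing_is_cvgn.
    by apply: nondecreasing_series => k _ _; exact: dotv_ge0.
  exists (B / sigma) => _ [n _ <-]; exact: inertial_km_summable.
move/cvg_series_cvg_0/cvgrPdist_le => /(_ _ e0) [N _ hN].
exists N.+1 => -[//|n] Nn; have := hN n Nn.
by rewrite /= sub0r normrN ger0_norm.
Qed.

(** The bounded iterates cluster at some [w]. Vanishing increments and Lipschitz continuity of [D]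
    give [D w = 0], so [w] can take the place of [p] in [km_cvg_of_cluster]. *)
Lemma inertial_km_cvg : exists2 w, D w = 0 & x n @[n --> \oo] --> w.
Proof.
have inball : (x @ \oo)
    [set w | dotv (w - p) (w - p) <= dotv (x 0%N - p) (x 0%N - p) / (1 - tau)].
  by exists 0%N => // n _; exact: km_bounded.
have [w [_ cw]] := compact_dotvv_ball _ inball.
have cl e N : 0 < e -> exists2 n, (N <= n)%N & dotv (x n - w) (x n - w) <= e.
  move=> e0.
  have /cvgrPdist_le/(_ _ e0) nw := @continuous_dotvv _ _ w w.
  have [] := cw [set x n | n in [set n | (N <= n)%N]] _ _ nw.
    by exists N => // n Nn; exists n.
  move=> _ [[n Nn <-]]; rewrite subrr dot0v sub0r normrN ger0_norm ?dotv_ge0//.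
  by exists n.
suff Dw : D w = 0 by exists w => //; exact: km_cvg_of_cluster.
(* The two summands bound [|D (W n)| <= 2 e / eps], where [lam n >= eps] enters, and
   [|D w - D (W n)| <= 2 e / c]. *)
pose M := 2 / eps + 2 / c.
have M0 : 0 < M by rewrite addr_gt0// divr_gt0.
suff small e : 0 < e -> enorm (D w) <= M * e.
  apply: dotv_eq0; rewrite -sqr_enorm.
  suff -> : enorm (D w) = 0 by rewrite expr0n.
  apply/eqP; rewrite eq_le enorm_ge0 andbT; apply/ler_addgt0Pl => e e0.
  by rewrite addr0 (le_trans (small _ (divr_gt0 e0 M0)))// mulrC divfK// gt_eqF.
move=> e0; have e20 : 0 < e ^+ 2 by rewrite exprn_gt0.
have [N hN] := increments_small e20.
(* Asking for an index from [N.+1] on makes it a successor [n.+1] with [N <= n], so that [W n] is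
   close to [w]. *)
have [[//|n] Nn xw] := cl _ N.+1 e20.
have normle u : dotv u u <= e ^+ 2 -> enorm u <= e.
  by rewrite -sqr_enorm ler_pXn2r ?nnegrE ?enorm_ge0 ?(ltW e0).
have d1 : enorm (x n.+1 - x n) <= e by apply: normle; exact: hN.
have d2 : enorm (x n.+2 - x n.+1) <= e by apply: normle; apply: hN; exact: ltnW.
have dW : enorm (tau_ n *: (x n.+1 - x n)) <= e.
  rewrite enormZ//; have := enorm_ge0 (x n.+1 - x n).
  by have := tau_ge0 n; have := ltW (le_lt_trans (tau_le n) tau1); nra.
have DW : enorm (D (W n)) <= 2 * e / eps.
  rewrite ler_pdivlMr// mulrC.
  apply: (@le_trans _ _ (enorm (lam n *: D (W n)))).
    by rewrite enormZ ?(ltW (lam0 n))// ler_wpM2r ?enorm_ge0.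
  have -> : lam n *: D (W n) = (x n.+2 - x n.+1) - tau_ n *: (x n.+1 - x n).
    by rewrite xS /W; apply/rowP => i; rewrite !mxE; ring.
  by have := enormD (x n.+2 - x n.+1) (- (tau_ n *: (x n.+1 - x n))); rewrite enormN; lra.
have Ww : enorm (w - W n) <= 2 * e.
  have -> : w - W n = - ((x n.+1 - w) + tau_ n *: (x n.+1 - x n)).
    by rewrite /W; apply/rowP => i; rewrite !mxE; ring.
  rewrite enormN; have := enormD (x n.+1 - w) (tau_ n *: (x n.+1 - x n)).
  by have := normle _ _ xw; lra.
have DwW : enorm (D w - D (W n)) <= c^-1 * (2 * e).
  by rewrite (le_trans (cocoercive_lipschitz _ _))// ler_wpM2l// invr_ge0 ltW.
have := enormD (D w - D (W n)) (D (W n)); rewrite subrK /M; lra.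
Qed.

End InertialKM.

(** * Zeros of the residual, optimality, and summability *)

Section Zeros.
Context {R : realType} {d : nat}.
Local Notation E := 'rV[R]_d.

(** Both proximal steps return [x]: the first argument minus [x] is [v], the second minus [x] is
    [- v - C x = u]. *)
Lemma davis_yin_residual_eq0 (F G : E -> \bar R) (C : E -> E) (x u v : E) :
  proper_efun F -> lower_semicontinuous F -> econvex F ->
  proper_efun G -> lower_semicontinuous G -> econvex G ->
  subdifferential F x u -> subdifferential G x v -> u + v + C x = 0 ->
  davis_yin_residual F G C (x + v) = 0.
Proof.
move=> Fp Fl Fc Gp Gl Gc xu xv uv0.
have Gx : prox G (x + v) = x by apply: prox_unique => //; rewrite addrC addKr.
rewrite /davis_yin_residual Gx; apply/eqP; rewrite subr_eq0; apply/eqP.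
apply: prox_unique => //.
suff -> : 2 *: x - (x + v) - C x - x = u by [].
have -> : u = - v - C x by apply/eqP; rewrite -subr_eq0 opprB opprK addrA addrAC uv0.
by move: (C x) => c; apply/rowP => i; rewrite !mxE; ring.
Qed.

(** Add the three subgradient inequalities; their slopes sum to zero. *)
Lemma argmin_of_subgradients (f g : E -> \bar R) (h : E -> R) (x u v : E) :
  proper_efun f -> proper_efun g -> (forall z, differentiable h z) ->
  convex_function [set: convex_lmodType E] h ->
  subdifferential f x u -> subdifferential g x v -> u + v + gradient h x = 0 ->
  argmin (fun z => f z + g z + (h z)%:E)%E x.
Proof.
move=> fp gp hd hc /(subdifferentialP _ _ fp)[a fx xu].
move=> /(subdifferentialP _ _ gp)[b gx xv] uv0 z.
rewrite fx gx; have := fp.1 z; have := gp.1 z.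
case gz : (g z) => [r| |]//; case fz : (f z) => [s| |]// _ _; rewrite ?leey//.
rewrite -!EFinD lee_fin.
have := xu _ _ fz; have := xv _ _ gz; have := convex_gradient_le hd hc x z.
have : dotv (z - x) (u + v + gradient h x) = 0 by rewrite uv0 dotvC dot0v.
rewrite (dotvDr _ (u + v)) (dotvDr _ u) [dotv _ (gradient h x)]dotvC; lra.
Qed.

Lemma summable_lt_pinfty (u : nat -> R) (B : R) : (forall n, 0 <= u n) ->
  (forall n, \sum_(0 <= k < n) u k.+1 <= B) ->
  (\sum_(1 <= n <oo) (u n)%:E < +oo)%E.
Proof.
move=> u0 uB; apply: (@le_lt_trans _ _ B%:E); last exact: ltry.
apply: lime_le; first by apply: is_cvg_nneseries => n _ _; rewrite lee_fin.
near=> n; rewrite sumEFin lee_fin big_add1; exact: uB.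
Unshelve. all: by end_near. Qed.

End Zeros.

(** * The inertial iteration applied to the Davis-Yin residual *)

Theorem theorem2 (R : realType) (d : nat)
  (f g : 'rV[R]_d -> \bar R) (h : 'rV[R]_d -> R) (L : R)
  (f_proper : proper_efun f) (f_lsc : lower_semicontinuous f) (f_convex : econvex f)
  (g_proper : proper_efun g) (g_lsc : lower_semicontinuous g) (g_convex : econvex g)
  (h_diff : forall x, differentiable h x)
  (h_convex : convex_function [set: convex_lmodType 'rV[R]_d] h)
  (L_gt0 : 0 < L)
  (h_lip : forall x y,
    enorm (gradient h x - gradient h y) <= L * enorm (x - y))
  (zer_nonempty :
    [set x : 'rV[R]_d | [set u + v + gradient h x |
        u in subdifferential f x & v in subdifferential g x] 0] !=set0)
  (gamma : R) (tau_ lambda_ : nat -> R)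
  (tau_gt0 : forall n, (1 <= n)%N -> 0 < tau_ n)
  (lambda_gt0 : forall n, (1 <= n)%N -> 0 < lambda_ n)
  (tau epsilon kappa delta sigma : R)
  (tau01 : 0 < tau < 1) (epsilon01 : 0 < epsilon < 1)
  (kappa01 : 0 < kappa < 1) (delta_gt0 : 0 < delta) (sigma_gt0 : 0 < sigma)
  (delta_lb :
    delta > (tau ^+ 2 * (1 + tau) + tau * sigma) / (1 - tau ^+ 2))
  (xbar w_ x_ y_ : nat -> 'rV[R]_d) :
  let beta := 1 / L in
  let alpha := 2 * beta / (4 * beta - gamma) in
  0 < gamma < 2 * beta * kappa ->
  (forall n, (1 <= n)%N -> tau_ n <= tau_ n.+1 <= tau) ->
  (forall n, (1 <= n)%N ->
    epsilon < lambda_ n <=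
      (delta - tau * (tau + tau ^+ 2 + tau * delta + sigma)) /
      (alpha * delta * (1 + tau + tau ^+ 2 + tau * delta + sigma))) ->
  xbar 0%N = xbar 1%N ->
  (forall n, (1 <= n)%N ->
    [/\ w_ n = xbar n + tau_ n *: (xbar n - xbar n.-1),
        x_ n = prox (fun z => gamma%:E * g z)%E (w_ n),
        y_ n = prox (fun z => gamma%:E * f z)%E
                 (2 *: x_ n - w_ n - gamma *: gradient h (x_ n)) &
        xbar n.+1 = w_ n + lambda_ n *: (y_ n - x_ n)]) ->
  exists w : 'rV[R]_d,
    [/\ (\sum_(1 <= n <oo) (enorm (xbar n.+1 - xbar n) ^+ 2)%:E < +oo)%E,
        xbar n @[n --> \oo] --> w,
        x_ n @[n --> \oo] --> prox (fun z => gamma%:E * g z)%E w &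
        argmin (fun x => f x + g x + (h x)%:E)%E
          (prox (fun z => gamma%:E * g z)%E w)].
Proof.
move=> beta alpha /andP[gamma0 gamma_lt] tau_mono lam_bd x01 iter.
have /andP[tau0 tau1] := tau01.
(* As [kappa < 1], [gamma L < 2], so the cocoercivity constant is positive. *)
have c0 : 0 < 1 - gamma * L / 4.
  have : gamma * L < 2 * kappa.
    by rewrite -ltr_pdivlMr//; move: gamma_lt; rewrite /beta; lra.
  by have /andP[_] := kappa01; lra.
(* With [c = 1 - gamma L / 4] this is [1 / (2 c)], so (iii) is the bound on [mu] cleared of its
   denominator. *)
have alphaE : alpha = (2 * (1 - gamma * L / 4))^-1.
  rewrite /alpha /beta; field.
  rewrite !gt_eqF//; lra.
have alpha0 : 0 < alpha by rewrite alphaE invr_gt0 mulr_gt0.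
pose F z := (gamma%:E * f z)%E; pose G z := (gamma%:E * g z)%E.
have Fp : proper_efun F := proper_efun_scale gamma0 f_proper.
have Gp : proper_efun G := proper_efun_scale gamma0 g_proper.
have Fl : lower_semicontinuous F := lower_semicontinuous_scale gamma0 f_lsc.
have Gl : lower_semicontinuous G := lower_semicontinuous_scale gamma0 g_lsc.
have Fc : econvex F := econvex_scale gamma0 f_proper f_convex.
have Gc : econvex G := econvex_scale gamma0 g_proper g_convex.
have [xs [u xsu [v xsv uv0]]] := zer_nonempty.
have hF : subdifferential F xs (gamma *: u) by apply/subdifferential_scale.
have hG : subdifferential G xs (gamma *: v) by apply/subdifferential_scale.
pose D := davis_yin_residual F G (fun x => gamma *: gradient h x).
have Dp : D (xs + gamma *: v) = 0.
  by apply: (davis_yin_residual_eq0 Fp _ _ Gp _ _ hF hG) => //;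
    rewrite -!scalerDr uv0 scaler0.
have D_coco w w' : (1 - gamma * L / 4) * dotv (D w - D w') (D w - D w') <=
    - dotv (w - w') (D w - D w').
  exact: (davis_yin_cocoercive w w' Fp Fl Fc hF Gp Gl Gc hG h_diff h_convex h_lip).
(* The parameters are shifted by one, since the inertial iteration counts from 0; [xbar] is not
   shifted. *)
have tau_ge0 n : 0 <= tau_ n.+1 by rewrite ltW// tau_gt0.
have tau_nd n : tau_ n.+1 <= tau_ n.+2 by have /andP[] := tau_mono n.+1 isT.
have tau_le n : tau_ n.+1 <= tau.
  by have /andP[+ +] := tau_mono n.+1 isT; exact: le_trans.
have eps0 : 0 < epsilon by have /andP[] := epsilon01.
have lam_ge n : epsilon <= lambda_ n.+1 by have /andP[/ltW] := lam_bd n.+1 isT.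
have mu_le n : lambda_ n.+1 / (2 * (1 - gamma * L / 4)) *
    (delta * (1 + (tau + tau ^+ 2 + tau * delta + sigma))) <=
    delta - tau * (tau + tau ^+ 2 + tau * delta + sigma).
  have /andP[_] := lam_bd n.+1 isT; rewrite ler_pdivlMr.
    by rewrite alphaE; apply: le_trans; rewrite le_eqVlt; apply/orP; left; apply/eqP; ring.
  have := mulr_gt0 tau0 delta_gt0; have := exprn_gt0 2 tau0 => ? ?.
  by apply: mulr_gt0; [exact: mulr_gt0 alpha0 delta_gt0|lra].
have xS n : xbar n.+2 = xbar n.+1 + tau_ n.+1 *: (xbar n.+1 - xbar n) +
    lambda_ n.+1 *: D (xbar n.+1 + tau_ n.+1 *: (xbar n.+1 - xbar n)).
  by have [wE xE yE ->] := iter n.+1 isT; rewrite yE xE wE.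
have [w Dw xw] := inertial_km_cvg c0 D_coco tau_ge0 tau_nd tau_le tau0 tau1 eps0
  delta_gt0 sigma_gt0 lam_ge mu_le x01 xS Dp.
have sumB := inertial_km_summable c0 D_coco tau_ge0 tau_nd tau_le tau0 tau1 eps0
  delta_gt0 sigma_gt0 lam_ge mu_le x01 xS Dp.
exists w; split=> //.
- apply: summable_lt_pinfty => n; first exact: sqr_ge0.
  by under eq_bigr do rewrite sqr_enorm; exact: sumB.
- apply/cvg_enormP/cvgrPdist_le => e e0.
  (* Three distances to [w] add up in [|w_ n.+1 - w|], the two from the inertial term carrying a
     factor at most 1. *)
  have /cvg_enormP/cvgrPdist_le/(_ _ (divr_gt0 e0 (ltr0Sn R 2)))[N _ hN] := xw.
  have small n : (N <= n)%N -> enorm (xbar n - w) <= e / 3.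
    by move=> /hN; rewrite /= sub0r normrN ger0_norm// enorm_ge0.
  exists N.+1 => // -[//|n] Nn; rewrite /= sub0r normrN ger0_norm ?enorm_ge0//.
  have [wE -> _ _] := iter n.+1 isT.
  apply: le_trans (prox_nonexpansive (w_ n.+1) w Gp Gl Gc hG) _.
  rewrite wE /=.
  have -> : xbar n.+1 + tau_ n.+1 *: (xbar n.+1 - xbar n) - w =
     (xbar n.+1 - w) + tau_ n.+1 *: ((xbar n.+1 - w) + - (xbar n - w)).
    by apply/rowP => i; rewrite !mxE; ring.
  apply: le_trans (enormD _ _) _; rewrite enormZ//.
  have := enormD (xbar n.+1 - w) (- (xbar n - w)); rewrite enormN.
  have := small n Nn; have := small n.+1 (leqW Nn).
  have := tau_ge0 n; have := le_trans (tau_le n) (ltW tau1).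
  have := enorm_ge0 (xbar n.+1 - w + - (xbar n - w)); nra.
- set x := prox _ w; have xE : prox G w = x by [].
  have wx : subdifferential G x (w - x) := prox_subdifferential w Gp Gl Gc hG.
  have yx := prox_subdifferential (2 *: x - w - gamma *: gradient h x) Fp Fl Fc hF.
  (* [D w = 0] makes both proximal points equal to [x]. Their optimality conditions, divided by
     [gamma], give subgradients of [f] and [g] that cancel the gradient. *)
  move/eqP: Dw; rewrite /D /davis_yin_residual xE subr_eq0 => /eqP yE.
  rewrite yE in yx.
  apply: (@argmin_of_subgradients _ _ f g h x
    (gamma^-1 *: (x - w) - gradient h x) (gamma^-1 *: (w - x))) => //.
  + apply/(subdifferential_scale gamma0 _ _ f_proper); move: yx.
    congr (subdifferential _ _ _); rewrite scalerBr scalerA divff ?gt_eqF// scale1r.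
    by move: (gamma *: _) => c; apply/rowP => i; rewrite !mxE; ring.
  + apply/(subdifferential_scale gamma0 _ _ g_proper).
    by rewrite scalerA divff ?gt_eqF// scale1r.
  + by rewrite addrAC subrK -scalerDr addrC addrA subrK subrr scaler0.
Qed.
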